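(* Let $F(z,\alpha;C)$ be the Radon hypergeometric function of type $\lambda$. Then the following transformation formulae hold (with the same cycle $C$ on both sides, $z\in Z$). (1) For $g\in W_\lambda$, $$F(zg,\alpha;C)=F(z,\alpha\cdot{}^t\rho(g);C).$$ (2) For $P_\sigma\in\mathcal P$ corresponding to $\sigma\in\prod_{1\le i\le s}\mathfrak S_{p_i}$, $$F(zP_\sigma,\sigma(\alpha);C)=F(z,\alpha;C).$$
   Context: Groups. Let $r,n$ be positive integers, $N=nr$, $G=\mathrm{GL}(N,\mathbb C)$, and $m$ an integer with $r<m<N$. $J_r(p)\subset\mathrm{GL}(pr)$ is the group of $p\times p$ block matrices with $(a,b)$-block ($r\times r$) equal to $h_{b-a}$ if $b\ge a$ and $0$ otherwise, $h_0\in\mathrm{GL}(r)$, $h_1,\dots,h_{p-1}\in\mathrm{Mat}(r)$. Let $\lambda=(\overbrace{n_1,\dots,n_1}^{p_1},\dots,\overbrace{n_s,\dots,n_s}^{p_s})$ be a partition of $n$, $n_1>\dots>n_s>0$. $H_\lambda\subset G$ is the group of block-diagonal matrices $h=\mathrm{diag}(h^{(i,k)})$, $1\le i\le s$, $1\le k\le p_i$ (lexicographic order), $h^{(i,k)}\in J_r(n_i)$; write $h^{(i,k)}_a$ ($0\le a<n_i$) for its entries. $\tilde H_\lambda,\tilde J_r(p)$ are universal covering groups. Weyl group. $\mu_{i,j}(x)$ is defined by $(x_1T+x_2T^2+\cdots)^i=\sum_{j\ge0}\mu_{i,j}(x)T^j$ ($0$-th power equal to $1$), and $W_r(p)=\{(\mu_{i,j}(c)1_r)_{0\le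 i,j<p}\mid c\in\mathbb C^{p-1},\ c_1\ne0\}\subset\mathrm{GL}(pr)$, $W_r(1)=\{1_r\}$. Put $U=\prod_iW_r(n_i)^{p_i}\subset G$ (block diagonal) and $\mathcal P=\prod_i\mathcal P_i\subset G$, where $\mathcal P_i\simeq\mathfrak S_{p_i}$ consists of $P_\sigma=(\delta_{j,\sigma(k)}1_{n_ir})_{1\le j,k\le p_i}$. The Weyl group $N_G(H_\lambda)/H_\lambda$ is identified with the subgroup $W_\lambda=U\rtimes\mathcal P\subset N_G(H_\lambda)$. Each $g\in W_\lambda$ is uniquely of the form $g=(g'_{a,b}1_r)_{1\le a,b\le n}$ with $g'\in\mathrm{GL}(n)$; $\rho:W_\lambda\to\mathrm{GL}(n)$ is the homomorphism $\rho(g)=g'$. Characters. For $\alpha=(\alpha^{(i,k)})\in\mathbb C^n$ (row vector), $\alpha^{(i,k)}=(\alpha^{(i,k)}_0,\dots,\alpha^{(i,k)}_{n_i-1})$, put $\chi(h;\alpha)=\prod_{i,k}\chi_{n_i}(h^{(i,k)};\alpha^{(i,k)})$, where on $\tilde J_r(p)$ $$\chi_p(h;\alpha)=(\det h_0)^{\alpha_0}\exp\Bigl(\sum_{1\le a<p}\alpha_a\operatorname{Tr}\theta_a(\underline h)\Bigr),\quad \underline h=h_0^{-1}h,$$ and, for $\underline h=1_r+\sum_{1\le a<p}\underline h_aw^a$ (identifying $J_r(p)$ with the units of $\mathrm{Mat}(r)[w]/(w^p)$), $\log\underline h=\sum_{1\le a<p}\theta_a(\underline h)w^a$. For $\sigma=(\sigma_1,\dots,\sigma_s)\in\prod_i\mathfrak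 S_{p_i}$, $P_\sigma=\mathrm{diag}(P_{\sigma_1},\dots,P_{\sigma_s})$ and $\sigma(\alpha)=\alpha\cdot\rho(P_\sigma)$, i.e. $\sigma(\alpha)^{(i,k)}=\alpha^{(i,\sigma_i(k))}$. It is assumed that (i) $\alpha_0^{(i,k)}\notin\mathbb Z$; (ii) $\alpha^{(i,k)}_{n_i-1}\ne0$ if $n_i\ge2$; (iii) $\sum_{i,k}\alpha_0^{(i,k)}=-m$. Radon hypergeometric function. $\iota:H_\lambda\to\mathrm{Mat}(r,N)$ sends $h$ to the row of $r\times r$ blocks $(h^{(i,k)}_0,\dots,h^{(i,k)}_{n_i-1})_{i,k}$; it is injective with Zariski open image. $Z$ is the set of $z=(z^{(i,k)}_a)\in\mathrm{Mat}(m,N)$ of rank $m$, with blocks $z^{(i,k)}_a\in\mathrm{Mat}(m,r)$ ($0\le a<n_i$), such that $\operatorname{rank}z_0^{(i,k)}=r$ for all $(i,k)$. Let $T=\mathrm{Gr}(r,m)=\mathrm{GL}(r)\backslash\{t\in\mathrm{Mat}(r,m):\operatorname{rank}t=r\}$, $X_z=\{[t]\in T:\det(tz^{(i,k)}_0)\ne0\ \forall i,k\}$, and $\tau(t)=(\det t')^m\bigwedge du_{i,j}$ where $t=(t',t'')$, $t'\in\mathrm{Mat}(r)$, $u=(t')^{-1}t''$. Write $\chi(tz;\alpha)$ for $\chi(\iota^{-1}(tz);\alpha)$, which is multivalued in $t$; $\chi(tz;\alpha)\tau(t)$ is a multivalued $r(m-r)$-form on $X_z$. Then $$F(z,\alpha;C)=\int_{C(z)}\chi(tz;\alpha)\,\tau(t),$$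 where $C(z)$ is a cycle of the homology group $H^{\Phi_z}_{r(m-r)}(X_z;\mathcal L_z)$ of locally finite chains with coefficients in the rank one local system $\mathcal L_z$ on $X_z$ defined by the monodromy of $\chi(tz;\alpha)\tau(t)$ and with supports in the family $\Phi_z$ of closed sets $A\subset X_z$ such that $A\cap\{\operatorname{Re}g_z\ge a\}$ is compact for all $a\in\mathbb R$, $g_z(t)=\sum_{i,k}\sum_{1\le a<n_i}\alpha_a^{(i,k)}\operatorname{Tr}\theta_a(\underline{tz}^{(i,k)})$ being the exponent of the exponential factor of $\chi(tz;\alpha)$. For $g\in W_\lambda$ and $z\in Z$ one has $zg\in Z$, $X_{zg}=X_z$, and in the formulae the same cycle is used on both sides, with corresponding branches of the integrand. *)

(* Defs.v *)
(* The complex numbers are R[i], for R : realType. *)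
From HB Require Import structures.
From mathcomp Require Import all_boot all_order all_algebra all_fingroup.
From mathcomp Require Import complex mxtens generic_quotient.
From mathcomp Require Import all_classical all_reals all_analysis.

Set Implicit Arguments.
Unset Strict Implicit.
Unset Printing Implicit Defensive.

Import Order.TTheory GRing.Theory Num.Theory numFieldNormedType.Exports.

Local Open Scope classical_set_scope.
Local Open Scope ring_scope.
Local Open Scope complex_scope.
Local Open Scope quotient_scope.

Definition cexp (R : realType) (x : R[i]) : R[i] :=
  (expR (complex.Re x) * cos (complex.Im x)) +i* (expR (complex.Re x) * sin (complex.Im x)).

Section Shape.
Variables (R : realType) (r s : nat) (p nu : 'I_s -> nat).
Local Notation C := R[i].

(* |lambda| for lambda = (nu_0 ^ p_0, .., nu_(s-1) ^ p_(s-1)); the nesting of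
   the sums makes 'M_size_lambda the type of the block matrices with s * s
   blocks, the i-th diagonal one having itself p_i * p_i blocks of size nu_i. *)
Definition size_lambda : nat := \sum_(i < s) \sum_(k < p i) nu i.
Local Notation n := size_lambda.

Definition lam_index (i : 'I_s) (k : 'I_(p i)) (a : 'I_(nu i)) : 'I_n :=
  tagnat.Rank (p_ := fun i : 'I_s => \sum_(k < p i) nu i)%N i
    (tagnat.Rank (p_ := fun _ : 'I_(p i) => nu i) k a).

(* alpha^(i,k)_a, extended by 0 to a >= nu i. *)
Definition acoef (alpha : 'rV[C]_n) (i : 'I_s) (k : 'I_(p i)) (a : nat) : C :=
  oapp (fun a : 'I_(nu i) => alpha 0 (lam_index k a)) 0 (insub a).

(* The block X^(i,k)_a (r columns) of X, extended by 0 to a >= nu i.  For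
   X in Mat(r, N) these are the entries h^(i,k)_a of h = iota^-1 X; an element
   of H_lambda is represented by this family of entries. *)
Definition blk (l : nat) (X : 'M[C]_(l, n * r)) (i : 'I_s) (k : 'I_(p i))
    (a : nat) : 'M[C]_(l, r) :=
  oapp (fun a : 'I_(nu i) =>
          \matrix_(x, y) X x (mxtens_index (lam_index k a, y)))
    0 (insub a).

(* theta_a(underline h), for h given by its entries h_0, .., h_(q-1).
   Mat(r)[w] is represented by 'M[{poly C}]_r, in which underline h - 1 is a
   multiple of w; hence the terms of order >= q of the series of log vanish
   modulo w^q, and do not contribute to theta_a, a < q. *)
Definition underline (q : nat) (h : nat -> 'M[C]_r) : 'M[{poly C}]_r :=
  \sum_(a < q) 'X^a *: map_mx polyC (invmx (h 0%N) *m h a).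

Definition theta (q : nat) (h : nat -> 'M[C]_r) (a : nat) : 'M[C]_r :=
  map_mx (coefp a)
    (\sum_(1 <= j < q)
       ((-1) ^+ j.-1 / j%:R)%:P *: (underline q h - 1%:M) ^+ j).

(* The universal covering group of H_lambda consists of the pairs (h, ell)
   where ell^(i,k) is a logarithm of det h^(i,k)_0. *)
Definition chi_jordan (q : nat) (h : nat -> 'M[C]_r) (ell : C)
    (al : nat -> C) : C :=
  cexp (al 0%N * ell) * cexp (\sum_(1 <= a < q) al a * \tr (theta q h a)).

Definition chi (h : forall i : 'I_s, 'I_(p i) -> nat -> 'M[C]_r)
    (ell : forall i : 'I_s, 'I_(p i) -> C) (alpha : 'rV[C]_n) : C :=
  \prod_(i < s) \prod_(k < p i)
    chi_jordan (nu i) (h i k) (ell i k) (acoef alpha k).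

(* All values at X of the multivalued function chi(iota^-1 X; alpha). *)
Definition chi_values (alpha : 'rV[C]_n) (X : 'M[C]_(r, n * r)) : set C :=
  [set chi (fun i => @blk r X i) ell alpha
     | ell in [set ell | forall (i : 'I_s) (k : 'I_(p i)),
                           cexp (ell i k) = \det (blk X k 0)]].

Definition gexp (alpha : 'rV[C]_n) (X : 'M[C]_(r, n * r)) : C :=
  \sum_(i < s) \sum_(k < p i) \sum_(1 <= a < nu i)
    acoef alpha k a * \tr (theta (nu i) (blk X k) a).

Definition Zset (m : nat) : set 'M[C]_(m, n * r) :=
  [set z | \rank z = m /\
           forall (i : 'I_s) (k : 'I_(p i)), \rank (blk z k 0) = r].

Definition mu_mx (q : nat) (c : nat -> C) : 'M[C]_q :=
  \matrix_(i, j) ((\sum_(1 <= l < q) c l *: 'X^l) ^+ i)`_j.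

Definition Uset : set 'M[C]_(n * r) :=
  [set (\mxdiag_(i < s) \mxdiag_(k < p i) mu_mx (nu i) (c i k)) *t 1%:M
     | c in [set c : forall i : 'I_s, 'I_(p i) -> nat -> C |
              forall (i : 'I_s) (k : 'I_(p i)), c i k 1%N != 0]].

Definition Pmx (sigma : forall i : 'I_s, 'S_(p i)) : 'M[C]_(n * r) :=
  (\mxdiag_(i < s) \mxblock_(j < p i, k < p i)
     (if j == sigma i k then 1%:M else 0 : 'M[C]_(nu i))) *t 1%:M.

Definition Wset : set 'M[C]_(n * r) :=
  [set g | exists u sigma, Uset u /\ g = u *m Pmx sigma].

(* rho g is the g' such that g = (g'_(a,b) 1_r); it is unique if 0 < r. *)
Definition rho (g : 'M[C]_(n * r)) : 'M[C]_n :=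
  xget 0 [set g' | g = g' *t (1%:M : 'M[C]_r)].

End Shape.

Section Grassmannian.
Variables (R : realType) (r m : nat).
Local Notation C := R[i].

(* C^o is C with the topology of its norm. *)
Definition frame_set : set 'M[C^o]_(r, m) := [set t | \rank t = r].
Local Notation frame := (set_type frame_set).

Definition frame_mx (t : frame) : 'M[C]_(r, m) := val t.

Definition gl_rel (t t' : frame) : bool :=
  `[< exists2 A : 'M[C]_r, A \in unitmx & frame_mx t' = A *m frame_mx t >].

Lemma gl_rel_refl : reflexive gl_rel.
Proof.
by move=> t; apply/asboolP; exists 1%:M; rewrite ?unitmx1 ?mul1mx.
Qed.

Lemma gl_rel_sym : symmetric gl_rel.
Proof.
suff H t t' : gl_rel t t' -> gl_rel t' t by move=> t t'; apply/idP/idP; apply: H.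
move=> /asboolP[A uA e]; apply/asboolP; exists (invmx A).
  by rewrite unitmx_inv.
by rewrite e mulKmx.
Qed.

Lemma gl_rel_trans : transitive gl_rel.
Proof.
move=> t2 t1 t3 /asboolP[A uA e] /asboolP[B uB e'].
by apply/asboolP; exists (B *m A); rewrite ?unitmx_mul ?uA ?uB// -mulmxA -e.
Qed.

Definition gl_equiv := EquivRel gl_rel gl_rel_refl gl_rel_sym gl_rel_trans.

Definition Gr := {eq_quot gl_equiv}.

HB.instance Definition _ := Topological.copy Gr (quotient_topology Gr).
HB.instance Definition _ := Quotient.on Gr.

(* tau(t) = (det t')^m /\ du_(i,j), with t = (t', t''), u = t'^-1 t''. *)
Section Tau.
Variable hrm : (r < m)%N.

Definition left_block (t : 'M[C]_(r, m)) : 'M[C]_r :=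
  colsub (widen_ord (ltnW hrm)) t.

Definition right_block (t : 'M[C]_(r, m)) : 'M[C]_(r, m - r) :=
  colsub (fun j => cast_ord (subnKC (ltnW hrm)) (rshift r j)) t.

(* The formula for tau is valid where det t' <> 0.  As tau(t *m B) is
   det(B)^r tau(t) for B in GL(m), the other points of T are reached after a
   permutation pi of the columns, at the cost of the factor sgn(pi)^r. *)
Definition chart_perm (t : 'M[C]_(r, m)) : 'S_m :=
  if left_block t \in unitmx then 1%g
  else odflt 1%g [pick pi : 'S_m | left_block (col_perm pi t) \in unitmx].

Definition affine_coord (pi : 'S_m) (t : 'M[C]_(r, m)) : 'M[C]_(r, m - r) :=
  invmx (left_block (col_perm pi t)) *m right_block (col_perm pi t).

Definition cpartial (d : nat) (f : 'rV[R]_d -> C) (k : 'I_d)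
    (x : 'rV[R]_d) : C :=
  'D_(delta_mx 0 k) (fun y => complex.Re (f y)) x
    +i* 'D_(delta_mx 0 k) (fun y => complex.Im (f y)) x.

(* The coefficient of dx_1 /\ .. /\ dx_d in the pullback of tau by sg, where
   d = r (m - r) and the du_(i,j) are in lexicographic order. *)
Definition tau_pullback (sg : 'rV[R]_(r * (m - r)) -> 'M[C]_(r, m))
    (x : 'rV[R]_(r * (m - r))) : C :=
  let pi := chart_perm (sg x) in
  (-1) ^+ (r * odd_perm pi) * \det (left_block (col_perm pi (sg x))) ^+ m *
  \det (\matrix_(k, l) cpartial (fun y => mxvec (affine_coord pi (sg y)) 0 l) k x).

End Tau.

End Grassmannian.

Section Simplex.
Variable R : realType.
Local Notation C := R[i].

Definition simplex (d : nat) : set 'rV[R]_d :=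
  [set x | (forall k, 0 <= x 0 k) /\ \sum_(k < d) x 0 k <= 1].

Definition barycentric (d : nat) (x : 'rV[R]_d) (k : nat) : R :=
  if k is k'.+1 then oapp (x 0) 0 (insub k') else 1 - \sum_(l < d) x 0 l.

(* The i-th face map: a 0 is inserted as i-th barycentric coordinate. *)
Definition face (d : nat) (i : 'I_d.+1) (x : 'rV[R]_d.-1) : 'rV[R]_d :=
  \row_(j < d)
    (if j.+1 == i :> nat then 0 else barycentric x (unbump i j.+1)).

Fixpoint differentiable_upto (k d : nat) (U : set 'rV[R]_d)
    (f : 'rV[R]_d -> R) : Prop :=
  (forall x, U x -> {for x, continuous f}) /\
  (if k is k'.+1 then
     forall j : 'I_d,
       (forall x, U x -> derivable f x (delta_mx 0 j)) /\
       differentiable_upto k' U ('D_(delta_mx 0 j) f)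
   else True).

Definition smooth_on_simplex (d : nat) (f : 'rV[R]_d -> R) : Prop :=
  exists U : set 'rV[R]_d,
    [/\ open U, @simplex d `<=` U & forall k, differentiable_upto k U f].

(* Integral over {x | 0 <= x_k, x_1 + .. + x_d <= b} as an iterated integral. *)
Fixpoint simplex_integral (d : nat) (b : R) : ('rV[R]_d -> R) -> R :=
  match d with
  | 0 => fun f => f 0
  | d'.+1 => fun f =>
      \int[lebesgue_measure]_(x in `[0, b])
        simplex_integral (b - x) (fun y : 'rV[R]_d' => f (row_mx x%:M y))
  end.

Definition csimplex_integral (d : nat) (f : 'rV[R]_d -> C) : C :=
  simplex_integral 1 (fun x => complex.Re (f x))
    +i* simplex_integral 1 (fun x => complex.Im (f x)).

End Simplex.

(* A chain \sum_j coef_j (sg_j (x) u_j) with coefficients in a local system of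
   multivalued functions.  The simplex sg_j of X_z is given by a lift to
   matrices of rank r, and u_j is the branch along sg_j having at the vertex 0
   the value init_j.  This is a countable family since X_z is a countable union
   of compact sets; terms with coef_j = 0 are to be ignored. *)
Record twisted_chain (R : realType) (r m d : nat) := TwistedChain {
  coef : nat -> R[i];
  spx : nat -> 'rV[R]_d -> set_type (@frame_set R r m);
  init : nat -> R[i]
}.

Section Radon.
Variables (R : realType) (r s m : nat) (p nu : 'I_s -> nat).
Local Notation C := R[i].
Local Notation n := (size_lambda p nu).
Local Notation T := (Gr R r m).
Local Notation frame := (set_type (@frame_set R r m)).
Local Notation rp x := (frame_mx (repr (x : T))).

Definition Xset (z : 'M[C]_(m, n * r)) : set T :=
  [set x | forall (i : 'I_s) (k : 'I_(p i)), \det (rp x *m blk z k 0) != 0].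

(* The family of supports; gexp alpha (t *m z) only depends on the class of t. *)
Definition Phi (z : 'M[C]_(m, n * r)) (alpha : 'rV[C]_n) : set (set T) :=
  [set A | (exists2 B : set T, closed B & A = B `&` Xset z) /\
           forall a : R,
             compact (A `&` [set x | a <= complex.Re (gexp alpha (rp x *m z))])].

(* The branch of chi(t z; alpha) along sg with value u at the vertex 0, i.e. the
   continuous selection of values with this initial value; it is unique on the
   simplex, as two of them have a continuous quotient with countably many
   values. *)
Definition chi_branch (d : nat) (z : 'M[C]_(m, n * r)) (alpha : 'rV[C]_n)
    (sg : 'rV[R]_d -> frame) (u : C) : 'rV[R]_d -> C :=
  xget (fun=> 0)
    [set f : 'rV[R]_d -> C |
       [/\ f 0 = u,
           {within @simplex R d, continuous (fun x => complex.Re (f x))},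
           {within @simplex R d, continuous (fun x => complex.Im (f x))} &
           forall x, simplex x ->
             chi_values alpha (frame_mx (sg x) *m z) (f x)]].

Definition carrier (d : nat) (c : twisted_chain R r m d) (j : nat) : set T :=
  [set \pi_T (spx c j x) | x in @simplex R d].

Definition support (d : nat) (c : twisted_chain R r m d) : set T :=
  \bigcup_(j in [set j | coef c j != 0]) carrier c j.

(* A locally finite chain of X_z with coefficients in L_z. *)
Definition radon_chain (d : nat) (z : 'M[C]_(m, n * r)) (alpha : 'rV[C]_n)
    (c : twisted_chain R r m d) : Prop :=
  (forall j, coef c j != 0 ->
     [/\ forall a b,
           smooth_on_simplex (fun x => complex.Re (frame_mx (spx c j x) a b)) /\
           smooth_on_simplex (fun x => complex.Im (frame_mx (spx c j x) a b)),
         carrier c j `<=` Xset z &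
         chi_values alpha (frame_mx (spx c j 0) *m z) (init c j)]) /\
  (forall x, Xset z x -> exists2 V : set T, nbhs x V &
     finite_set [set j | coef c j != 0 /\ carrier c j `&` V !=set0]).

(* The coefficient at a lifted (d-1)-simplex tau of the boundary of c, as the
   value of a section of L_z at the vertex 0 of tau: the faces considered are
   those equal to tau in X_z.  If t' = A t, where A = t' *m pinvmx t, the branches
   of chi(t' z; alpha) are those of chi(t z; alpha) multiplied by det(A)^-m,
   since the alpha^(i,k)_0 have sum -m. *)
Definition boundary_coef (d : nat) (z : 'M[C]_(m, n * r)) (alpha : 'rV[C]_n)
    (c : twisted_chain R r m d) (tau : 'rV[R]_d.-1 -> frame) : C :=
  \sum_(ji \in [set ji : nat * 'I_d.+1 |
        coef c ji.1 != 0 /\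
        forall x, simplex x ->
          \pi_T (spx c ji.1 (face ji.2 x)) = \pi_T (tau x)])
    (-1) ^+ ji.2 * coef c ji.1 *
    chi_branch z alpha (spx c ji.1) (init c ji.1) (face ji.2 0) *
    \det (frame_mx (tau 0) *m pinvmx (frame_mx (spx c ji.1 (face ji.2 0)))) ^- m.

(* Cycles representing the elements of H_d^(Phi_z)(X_z; L_z). *)
Definition radon_cycle (d : nat) (z : 'M[C]_(m, n * r)) (alpha : 'rV[C]_n)
    (c : twisted_chain R r m d) : Prop :=
  [/\ radon_chain z alpha c,
      Phi z alpha (support c) &
      forall tau, boundary_coef z alpha c tau = 0].

Definition radon_term (hrm : (r < m)%N) (z : 'M[C]_(m, n * r))
    (alpha : 'rV[C]_n) (c : twisted_chain R r m (r * (m - r))) (j : nat) : C :=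
  coef c j * csimplex_integral (fun x =>
    chi_branch z alpha (spx c j) (init c j) x *
    tau_pullback hrm (fun y => frame_mx (spx c j y)) x).

(* F(z, alpha; c), the integral of chi(t z; alpha) tau(t) over c. *)
Definition radon_F (hrm : (r < m)%N) (z : 'M[C]_(m, n * r))
    (alpha : 'rV[C]_n) (c : twisted_chain R r m (r * (m - r))) : C :=
  limn (fun N => \sum_(j < N) complex.Re (radon_term hrm z alpha c j))
    +i* limn (fun N => \sum_(j < N) complex.Im (radon_term hrm z alpha c j)).

End Radon.

(* Main.v *)
Require Import Defs.
From HB Require Import structures.
From mathcomp Require Import all_boot all_order all_algebra all_fingroup.
From mathcomp Require Import complex mxtens.
From mathcomp Require Import all_classical all_reals all_analysis.
Import Order.TTheory GRing.Theory Num.Theory numFieldNormedType.Exports.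
Local Open Scope classical_set_scope.
Local Open Scope ring_scope.
Local Open Scope complex_scope.

(* The cycle condition and the integral depend on z and alpha only through X_z,
   the values of chi(tz; alpha) and the exponent g_z.  On the entries of h,
   right multiplication by an element of W_r(q) is the substitution
   w -> c_1 w + c_2 w^2 + .. in Mat(r)[w]/(w^q); it commutes with log, so that
   theta_b of the product is \sum_a mu_(a,b) theta_a(h), and the coefficients
   mu can be moved to alpha.  Permutations only reindex the factors of chi.
   Formula (2) is (1) for alpha * rho(P), since rho(P) is orthogonal. *)

(** * Congruence modulo ['X^q] of matrices of polynomials *)

Section MatrixPolyCongruence.
Context {F : comNzRingType} {r : nat}.
Implicit Types (q j : nat) (A B : 'M[{poly F}]_r).

(** Equality in Mat(r)[w]/(w^q), on representatives, since [underline] is a matrix of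
    polynomials. *)
Definition eqmodX q A B : Prop := exists D : 'M[{poly F}]_r, A = B + 'X^q *: D.

Lemma eqmodXM q A A' B B' :
  eqmodX q A B -> eqmodX q A' B' -> eqmodX q (A *m A') (B *m B').
Proof.
move=> [D ->] [D' ->]; exists (B *m D' + D *m (B' + 'X^q *: D')).
by rewrite mulmxDl mulmxDr -scalemxAr -scalemxAl -addrA -scalerDr.
Qed.

Lemma eqmodX_exp q A B j : eqmodX q A B -> eqmodX q (A ^+ j) (B ^+ j).
Proof.
move=> AB; elim: j => [|j IHj]; first by exists 0; rewrite scaler0 addr0.
by rewrite !exprS; apply: eqmodXM.
Qed.

Lemma eqmodX_sum q (I : Type) (s : seq I) (a : I -> {poly F})
    (A B : I -> 'M[{poly F}]_r) :
  (forall i, eqmodX q (A i) (B i)) ->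
  eqmodX q (\sum_(i <- s) a i *: A i) (\sum_(i <- s) a i *: B i).
Proof.
move=> AB; elim/big_ind2: _ => [|x y x' y' [D ->] [D' ->]|i _].
- by exists 0; rewrite scaler0 addr0.
- by exists (D + D'); rewrite scalerDr addrACA.
- have [D ->] := AB i; exists (a i *: D).
  by rewrite scalerDr !scalerA mulrC.
Qed.

Lemma eqmodX_coef q A B b : eqmodX q A B -> (b < q)%N ->
  map_mx (coefp b) A = map_mx (coefp b) B.
Proof.
move=> [D ->] bq; apply/matrixP => x y.
by rewrite !mxE /coefp/= coefD coefXnM bq addr0.
Qed.

Lemma map_comp_polyX (f : {poly F}) A j :
  map_mx (comp_poly f) (A ^+ j) = map_mx (comp_poly f) A ^+ j.
Proof.
elim: j => [|j IHj]; first by rewrite !expr0 map_mx1.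
by rewrite !exprS -IHj; apply: map_mxM.
Qed.

End MatrixPolyCongruence.

(** * The logarithm under a substitution w -> phi(w) *)

Section LogSubstitution.
Context {R : realType} {r : nat}.
Local Notation C := R[i].
Variable phi : {poly C}.
Hypothesis phi0 : phi`_0 = 0.

(** Without constant term, [phi] is a multiple of ['X], so its a-th power is a multiple of ['X^a]:
    the matrix (mu_(a,b)) is upper triangular. *)
Lemma coef_expr_lt a b : (b < a)%N -> (phi ^+ a)`_b = 0.
Proof.
have -> : phi = 'X * drop_poly 1 phi.
  by rewrite -[LHS](poly_take_drop 1) /take_poly poly_def big_ord1 phi0 scale0r add0r mulrC.
by move=> ab; rewrite exprMn coefXnM ab.
Qed.

Lemma coef_expr0 b : (phi ^+ 0)`_b = (b == 0)%N%:R.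
Proof. by rewrite expr0 coef1. Qed.

Variables (q : nat) (h h' : nat -> 'M[C]_r).
(** That is, [h'] is [h] times (mu_(a,b) 1_r), where mu_(a,b) is the coefficient of w^b in phi^a. *)
Hypothesis hh' : forall b, (b < q)%N ->
  h' b = \sum_(a < q) (phi ^+ a)`_b *: h a.

Lemma subst_block0 : (0 < q)%N -> h' 0%N = h 0%N.
Proof.
move=> q0; rewrite hh'// (bigD1 (Ordinal q0))//= coef_expr0 scale1r.
rewrite big1 ?addr0// => -[[|a] ?] // _.
by rewrite coef_expr_lt// scale0r.
Qed.

(** Substitution turns [underline q h] into the sum of the phi^a h_0^-1 h_a, and [underline q h'] is
    its truncation below degree q, as [h] and [h'] have the same block 0. *)
Lemma underline_subst : (0 < q)%N ->
  eqmodX q (underline q h') (map_mx (comp_poly phi) (underline q h)).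
Proof.
move=> q0.
pose G a : 'M[{poly C}]_r := map_mx polyC (invmx (h 0%N) *m h a).
(* [drop_poly] collects the terms of degree at least q, which the truncation omits; hence the minus
   sign. *)
exists (- \sum_(a < q) drop_poly q (phi ^+ a) *: G a).
have -> : map_mx (comp_poly phi) (underline q h) = \sum_(a < q) phi ^+ a *: G a.
  rewrite /underline raddf_sum; apply: eq_bigr => a _ /=.
  rewrite map_mxZ rmorphXn/= comp_polyX; congr (_ *: _).
  by apply/matrixP => x y; rewrite !mxE comp_polyC.
rewrite scalerN scaler_sumr -sumrB.
have -> : underline q h' =
    \sum_(b < q) \sum_(a < q) ((phi ^+ a)`_b *: 'X^b) *: G a.
  apply: eq_bigr => b _; rewrite subst_block0// hh'//.
  rewrite mulmx_sumr raddf_sum scaler_sumr; apply: eq_bigr => a _ /=.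
  rewrite -scalemxAr map_mxZ scalerA.
  by rewrite mulrC mul_polyC.
rewrite exchange_big/=; apply: eq_bigr => a _; rewrite -scaler_suml scalerA.
rewrite -scalerBl; congr (_ *: _); apply: (canRL (addrK _)).
by rewrite -[RHS](poly_take_drop q) /take_poly poly_def mulrC.
Qed.

(** Substitution is a ring morphism, so it commutes with the truncated series L of log, which
    respects congruence modulo ['X^q]. The coefficients of L(phi(w)) are then read off from those of
    the phi^a. *)
Lemma theta_subst b : (b < q)%N ->
  theta q h' b = \sum_(a < q) (phi ^+ a)`_b *: theta q h a.
Proof.
move=> bq; have q0 : (0 < q)%N by exact: leq_ltn_trans bq.
pose A := underline q h - 1%:M.
have AA' : eqmodX q (underline q h' - 1%:M) (map_mx (comp_poly phi) A).
  have [D ->] := underline_subst q0; exists D.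
  by rewrite map_mxB map_mx1 addrAC.
pose L := \sum_(1 <= j < q) ((-1) ^+ j.-1 / j%:R)%:P *: A ^+ j.
rewrite /theta (eqmodX_coef _ _ (map_mx (comp_poly phi) L) _ _ bq); last first.
  rewrite /L raddf_sum/=.
  under [X in eqmodX _ _ X]eq_bigr do rewrite map_mxZ/= comp_polyC map_comp_polyX.
  by apply: eqmodX_sum => j; apply: eqmodX_exp.
rewrite -/A -/L; apply/matrixP => x y.
rewrite 2!mxE [LHS]coef_comp_poly [RHS]summxE.
under [RHS]eq_bigr do rewrite 2!mxE mulrC.
set N := size _.
rewrite -(big_mkord xpredT (fun a => (L x y)`_a * (phi ^+ a)`_b)).
rewrite -[RHS](big_mkord xpredT (fun a => (L x y)`_a * (phi ^+ a)`_b)).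
(* The composition formula sums up to the size of the polynomial, the claim up to q. Both sums
   extend to [maxn N q]: from N on the coefficients of L vanish, and from q on those of phi^a do, as
   b < q <= a. *)
transitivity (\sum_(0 <= a < maxn N q) (L x y)`_a * (phi ^+ a)`_b).
  rewrite [RHS](big_cat_nat (n := N)) ?leq_maxl//= [X in _ + X]big_nat [X in _ + X]big1 ?addr0//.
  by move=> a /andP[Na _]; rewrite nth_default ?mul0r.
rewrite (big_cat_nat (n := q)) ?leq_maxr//= [X in _ + X]big_nat [X in _ + X]big1 ?addr0//.
by move=> a /andP[qa _]; rewrite coef_expr_lt ?mulr0// (leq_trans bq).
Qed.

End LogSubstitution.

(** * The character of one Jordan block *)

Section CharacterSubstitution.
Context {R : realType} {r : nat}.
Local Notation C := R[i].
Variables (phi : {poly C}) (q : nat) (h h' : nat -> 'M[C]_r) (al al' : nat -> C).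
Hypotheses (phi0 : phi`_0 = 0) (q_gt0 : (0 < q)%N).
Hypothesis hh' : forall b, (b < q)%N ->
  h' b = \sum_(a < q) (phi ^+ a)`_b *: h a.
Hypothesis al_al' : forall a, (a < q)%N ->
  al' a = \sum_(b < q) al b * (phi ^+ a)`_b.

Let sum_ordE {V : nmodType} (F : nat -> V) :
  \sum_(a < q) F a = F 0%N + \sum_(1 <= a < q) F a.
Proof. by rewrite -(big_mkord xpredT F) big_ltn. Qed.

(** Row 0 of mu is (1, 0, .., 0), because the 0-th power is 1. *)
Lemma subst_exponent0 : al' 0%N = al 0%N.
Proof.
rewrite (al_al' _ q_gt0) (sum_ordE (fun b => al b * (phi ^+ 0)`_b)).
rewrite coef_expr0 mulr1 big_nat big1 ?addr0// => b /andP[b0 _].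
by rewrite coef_expr0 eqn0Ngt b0 mulr0.
Qed.

(** Both sides are the sum of al_b mu_(a,b) Tr theta_a over a, b >= 1, taken in the two orders. The
    index 0 drops out since mu_(0,b) = 0 for b > 0 and mu_(a,0) = 0 for a > 0. *)
Lemma exponent_subst : \sum_(1 <= b < q) al b * \tr (theta q h' b) =
  \sum_(1 <= a < q) al' a * \tr (theta q h a).
Proof.
transitivity (\sum_(1 <= b < q) \sum_(1 <= a < q)
    al b * ((phi ^+ a)`_b * \tr (theta q h a))).
  apply: eq_big_nat => b /andP[b0 bq]; rewrite -mulr_sumr; congr (_ * _).
  rewrite (theta_subst _ phi0 _ _ _ hh' _ bq) [LHS](raddf_sum (@mxtrace C r)).
  rewrite (sum_ordE (fun a => \tr ((phi ^+ a)`_b *: theta q h a))).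
  rewrite coef_expr0 eqn0Ngt b0 scale0r mxtrace0 add0r.
  by apply: eq_bigr => a _; apply: mxtraceZ.
rewrite exchange_big_nat; apply: eq_big_nat => a /andP[a0 aq].
rewrite (al_al' _ aq) (sum_ordE (fun b => al b * (phi ^+ a)`_b)).
rewrite coef_expr_lt// mulr0 add0r mulr_suml.
by apply: eq_bigr => b _; rewrite mulrA.
Qed.

Lemma chi_jordan_subst ell :
  chi_jordan q h' ell al = chi_jordan q h ell al'.
Proof.
rewrite /chi_jordan.
apply: (congr2 *%R (congr1 (@cexp R) _) (congr1 (@cexp R) exponent_subst)).
by rewrite subst_exponent0.
Qed.

End CharacterSubstitution.

(** * Sums along a column of a block matrix *)

Section BlockSums.
Context {S : pzRingType} {V : lmodType S}.

Lemma sum_Rank {I : nat} (p_ : 'I_I -> nat) (f : 'I_(\sum_i p_ i) -> V) :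
  \sum_x f x = \sum_i \sum_(a < p_ i) f (tagnat.Rank i a).
Proof.
rewrite (reindex _ tagnat.rank_bij_on).
rewrite (sig_big_dep xpredT (fun _ => xpredT) (fun i a => f (tagnat.Rank i a))).
by apply: eq_bigr => -[].
Qed.

(** With values in a module, one formula serves for the blocks of X and for the entries of alpha. *)
Lemma sum_mxblock_col {I J : nat} (p_ : 'I_I -> nat) (q_ : 'I_J -> nat)
    (B : forall i j, 'M[S]_(p_ i, q_ j)) (f : 'I_(\sum_i p_ i) -> V) j b :
  \sum_x (\mxblock_(i, j) B i j) x (tagnat.Rank j b) *: f x =
  \sum_i \sum_(a < p_ i) B i j a b *: f (tagnat.Rank i a).
Proof.
rewrite sum_Rank; apply: eq_bigr => i _; apply: eq_bigr => a _.
by have /matrixP/(_ a b) := mxblockK B i j; rewrite mxE => ->.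
Qed.

Lemma sum_mxdiag_col {I : nat} (p_ : 'I_I -> nat)
    (B : forall i, 'M[S]_(p_ i)) (f : 'I_(\sum_i p_ i) -> V) j b :
  \sum_x (\mxdiag_i B i) x (tagnat.Rank j b) *: f x =
  \sum_(a < p_ j) B j a b *: f (tagnat.Rank j a).
Proof.
rewrite sum_mxblock_col (bigD1 j)//= eqxx conform_mx_id [X in _ + X]big1 ?addr0// => i ij.
by rewrite (negPf ij) big1// => a _; rewrite mxE scale0r.
Qed.

End BlockSums.

(** * The action of U and of the permutations on column blocks and on exponents *)

Section Weyl.
Context {R : realType} {r s : nat} {p nu : 'I_s -> nat}.
Local Notation C := R[i].
Local Notation n := (size_lambda p nu).

Definition block_col {l : nat} (X : 'M[C]_(l, n * r)) (I : 'I_n) : 'M[C]_(l, r) :=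
  \matrix_(x, y) X x (mxtens_index (I, y)).

(** The factor 1_r never mixes the columns inside a block, so g combines whole blocks with scalar
    coefficients. *)
Lemma block_col_mul_tens1 l (X : 'M[C]_(l, n * r)) (g : 'M[C]_n) (J : 'I_n) :
  block_col (X *m (g *t 1%:M)) J = \sum_I g I J *: block_col X I.
Proof.
apply/matrixP => x y; rewrite [LHS]mxE [LHS]mxE [RHS]summxE.
rewrite (reindex (@mxtens_index n r)); last first.
  by exists (@mxtens_unindex n r) => i _; rewrite (mxtens_indexK, mxtens_unindexK).
transitivity (\sum_I \sum_y' X x (mxtens_index (I, y')) *
    (g *t 1%:M) (mxtens_index (I, y')) (mxtens_index (J, y))).
  by rewrite pair_bigA; apply: eq_bigr => -[].
apply: eq_bigr => I _; rewrite (bigD1 y)//= [X in _ + X]big1 ?addr0 => [|y' yy'].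
  by rewrite tensmxE !mxE eqxx mulr1 mulrC.
by rewrite tensmxE !mxE (negPf yy') !mulr0.
Qed.

Lemma blk_ord l (X : 'M[C]_(l, n * r)) i (k : 'I_(p i)) (a : 'I_(nu i)) :
  blk X k a = block_col X (lam_index k a).
Proof. by rewrite /blk valK. Qed.

Lemma acoef_ord (al : 'rV[C]_n) i (k : 'I_(p i)) (a : 'I_(nu i)) :
  acoef al k a = al 0 (lam_index k a).
Proof. by rewrite /acoef valK. Qed.

(** Decoding the outer rank and then the inner one shows that every index is a [lam_index]. *)
Lemma eq_lam_index (V : Type) (f g : 'I_n -> V) :
  (forall i (k : 'I_(p i)) a, f (lam_index k a) = g (lam_index k a)) -> f =1 g.
Proof.
move=> fg x; rewrite -[x]tagnat.sig2K; move: (tagnat.sig2 x) => y.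
by rewrite -[y]tagnat.sig2K; apply: fg.
Qed.

(** The matrices g' for which g' tensored with 1_r lies in U; [P_mx] is the analogue for [Pmx]. *)
Definition U_mx (c : forall i : 'I_s, 'I_(p i) -> nat -> C) : 'M[C]_n :=
  \mxdiag_(i < s) \mxdiag_(k < p i) mu_mx (nu i) (c i k).

Definition P_mx (sigma : forall i : 'I_s, 'S_(p i)) : 'M[C]_n :=
  \mxdiag_(i < s) \mxblock_(j < p i, k < p i)
     (if j == sigma i k then 1%:M else 0 : 'M[C]_(nu i)).

Lemma sum_U_mx_col (V : lmodType C) c (f : 'I_n -> V) i (k : 'I_(p i)) b :
  \sum_I U_mx c I (lam_index k b) *: f I =
  \sum_a mu_mx (nu i) (c i k) a b *: f (lam_index k a).
Proof.
rewrite /U_mx /lam_index sum_mxdiag_col.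
by rewrite (sum_mxdiag_col _ _ (fun a => f (tagnat.Rank i a))).
Qed.

Lemma sum_U_mx_row (V : lmodType C) c (f : 'I_n -> V) i (k : 'I_(p i)) a :
  \sum_I (U_mx c)^T I (lam_index k a) *: f I =
  \sum_b mu_mx (nu i) (c i k) a b *: f (lam_index k b).
Proof.
rewrite /U_mx /lam_index tr_mxdiag sum_mxdiag_col.
rewrite tr_mxdiag (sum_mxdiag_col _ _ (fun a => f (tagnat.Rank i a))).
by apply: eq_bigr => b _; rewrite mxE.
Qed.

Lemma sum_P_mx_col (V : lmodType C) sigma (f : 'I_n -> V) i (k : 'I_(p i)) b :
  \sum_I P_mx sigma I (lam_index k b) *: f I = f (lam_index (sigma i k) b).
Proof.
rewrite /P_mx /lam_index sum_mxdiag_col.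
rewrite (sum_mxblock_col _ _ _ (fun a => f (tagnat.Rank i a))).
rewrite (bigD1 (sigma i k))//= eqxx [X in _ + X]big1 ?addr0 => [|j /negPf jk].
  rewrite (bigD1 b)//= [X in _ + X]big1 ?addr0 => [|a /negPf ab].
    by rewrite mxE eqxx scale1r.
  by rewrite mxE ab scale0r.
by rewrite jk big1// => a _; rewrite mxE scale0r.
Qed.

Lemma tr_P_mx sigma : (P_mx sigma)^T = P_mx (fun i => (sigma i)^-1%g).
Proof.
rewrite /P_mx tr_mxdiag; apply: eq_mxdiag => i; rewrite tr_mxblock.
apply: eq_mxblock => j k; rewrite [k == _]eq_sym (can2_eq (permK _) (permKV _)).
by case: ifP => _; rewrite ?trmx1 ?trmx0.
Qed.

Lemma P_mxT_mul (al : 'rV[C]_n) sigma : al *m P_mx sigma *m (P_mx sigma)^T = al.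
Proof.
rewrite tr_P_mx; apply/rowP; apply: eq_lam_index => i k a; rewrite mxE.
under eq_bigr do rewrite mulrC.
(* [C^o] is the field as a module over itself, where scaling is multiplication. *)
rewrite (sum_P_mx_col C^o) mxE; under eq_bigr do rewrite mulrC.
by rewrite (sum_P_mx_col C^o) permKV.
Qed.

End Weyl.

(** * Covariance of the character under W_lambda *)

Section Covariance.
Context {R : realType} {r s : nat} {p nu : 'I_s -> nat}.
Local Notation C := R[i].
Local Notation n := (size_lambda p nu).
Hypothesis nu_gt0 : forall i, (0 < nu i)%N.

(** This gathers what cycles and integrals see of z and alpha: the values of chi, the exponent g_z
    and the condition defining X_z. Quantifying over all [al] and [X] makes it stable under
    products. *)
Definition chi_covariant (g : 'M[C]_n) : Prop :=
  forall (al : 'rV[C]_n) (X : 'M[C]_(r, n * r)),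
  [/\ chi_values al (X *m (g *t 1%:M)) = chi_values (al *m g^T) X,
      gexp al (X *m (g *t 1%:M)) = gexp (al *m g^T) X &
      (forall i (k : 'I_(p i)), \det (blk (X *m (g *t 1%:M)) k 0) != 0) <->
      (forall i (k : 'I_(p i)), \det (blk X k 0) != 0)].

(** Transposition reverses products: [g'] is used at X g, then [g] at alpha g'^T. *)
Lemma chi_covariantM g g' :
  chi_covariant g -> chi_covariant g' -> chi_covariant (g *m g').
Proof.
move=> cg cg' al X.
have -> : X *m ((g *m g') *t 1%:M) = X *m (g *t 1%:M) *m (g' *t 1%:M).
  by rewrite -mulmxA tensmx_mul mul1mx.
have -> : al *m (g *m g')^T = al *m g'^T *m g^T by rewrite trmx_mul mulmxA.
have [c1 c2 c3] := cg (al *m g'^T) X.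
have [c1' c2' c3'] := cg' al (X *m (g *t 1%:M)).
by split; [rewrite c1' | rewrite c2' | exact: iff_trans c3' c3].
Qed.

Lemma chi_covariant_U c : chi_covariant (U_mx c).
Proof.
move=> al X.
(* The b-th coefficient of [phi i k ^+ a] is the entry (a, b) of [mu_mx]. *)
pose phi i (k : 'I_(p i)) : {poly C} := \sum_(1 <= l < nu i) c i k l *: 'X^l.
have phi0 i k : (phi i k)`_0 = 0.
  rewrite coef_sum big_nat big1// => l /andP[l1 _].
  by rewrite coefZ coefXn eq_sym (gtn_eqF l1) mulr0.
have blkE i (k : 'I_(p i)) b : (b < nu i)%N ->
    blk (X *m (U_mx c *t 1%:M)) k b =
    \sum_(a < nu i) (phi i k ^+ a)`_b *: blk X k a.
  move=> bi; rewrite -[b]/(val (Ordinal bi)) blk_ord block_col_mul_tens1.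
  rewrite sum_U_mx_col; apply: eq_bigr => a _.
  by rewrite mxE blk_ord.
have acoefE i (k : 'I_(p i)) a : (a < nu i)%N ->
    acoef (al *m (U_mx c)^T) k a =
    \sum_(b < nu i) acoef al k b * (phi i k ^+ a)`_b.
  move=> ai; rewrite -[a]/(val (Ordinal ai)) acoef_ord mxE.
  under eq_bigr do rewrite mulrC.
  rewrite (sum_U_mx_row C^o); apply: eq_bigr => b _.
  by rewrite mxE acoef_ord mulrC.
have blk0 i (k : 'I_(p i)) : blk (X *m (U_mx c *t 1%:M)) k 0 = blk X k 0.
  by rewrite (subst_block0 _ (phi0 i k) _ _ _ (blkE i k)).
split; last by split=> H i k; move: (H i k); rewrite blk0.
(* As block 0 is unchanged, both sets of values are indexed by the same logarithms [ell] and compare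
   factor by factor. *)
- rewrite /chi_values; under [X in image X _]eq_set do
    under eq_forall do under eq_forall do rewrite blk0.
  apply: eq_imagel => ell _; rewrite /chi.
  apply: eq_bigr => i _; apply: eq_bigr => k _.
  exact: (chi_jordan_subst _ _ _ _ _ _ (phi0 i k) (nu_gt0 i) (blkE i k) (acoefE i k)).
- apply: eq_bigr => i _; apply: eq_bigr => k _.
  exact: (exponent_subst _ _ _ _ _ _ (phi0 i k) (nu_gt0 i) (blkE i k) (acoefE i k)).
Qed.

Lemma chi_covariant_P sigma : chi_covariant (P_mx sigma).
Proof.
move=> al X.
have blkE i (k : 'I_(p i)) b :
    blk (X *m (P_mx sigma *t 1%:M)) k b = blk X (sigma i k) b.
  (* For b >= nu i both sides take the default value 0. *)
  have [bi|bi] := ltnP b (nu i); last by rewrite /blk insubF// ltnNge bi.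
  rewrite -[b]/(val (Ordinal bi)) !blk_ord block_col_mul_tens1.
  exact: sum_P_mx_col.
have acoefE i (k : 'I_(p i)) a :
    acoef (al *m (P_mx sigma)^T) (sigma i k) a = acoef al k a.
  have [ai|ai] := ltnP a (nu i); last by rewrite /acoef insubF// ltnNge ai.
  rewrite -[a]/(val (Ordinal ai)) !acoef_ord mxE tr_P_mx.
  under eq_bigr do rewrite mulrC.
  by rewrite (sum_P_mx_col C^o) permK.
have {}blkE i k : blk (X *m (P_mx sigma *t 1%:M)) k = blk X (sigma i k).
  exact/funext/blkE.
have {}acoefE i k : acoef (al *m (P_mx sigma)^T) (sigma i k) = acoef al k.
  exact/funext/acoefE.
split.
- have chiE (ell : forall i : 'I_s, 'I_(p i) -> C) :
      chi (fun i => @blk R r s p nu r (X *m (P_mx sigma *t 1%:M)) i)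
        (fun i k => ell i (sigma i k)) al =
      chi (fun i => @blk R r s p nu r X i) ell (al *m (P_mx sigma)^T).
    apply: eq_bigr => i _.
    rewrite [RHS](reindex_inj (@perm_inj _ (sigma i))).
    by apply: eq_bigr => k _; rewrite blkE acoefE.
  apply/seteqP; split=> _ [ell ellX <-].
    have ellE : ell = fun i k => ell i ((sigma i)^-1%g (sigma i k)).
      by apply: functional_extensionality_dep => i; apply/funext => k; rewrite permK.
    (* The logarithms travel with the blocks: the one chosen at k for X P belongs to the block sigma
       k of X. *)
    exists (fun i k => ell i ((sigma i)^-1%g k)) => [i k|].
      by rewrite ellX blkE permKV.
    rewrite [in RHS]ellE.
    exact: esym (chiE (fun i k => ell i ((sigma i)^-1%g k))).
  by exists (fun i k => ell i (sigma i k)) => // i k; rewrite ellX blkE.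
- rewrite /gexp; apply: eq_bigr => i _.
  rewrite [RHS](reindex_inj (@perm_inj _ (sigma i))).
  by apply: eq_bigr => k _; rewrite blkE acoefE.
- split=> H i k; last by rewrite blkE.
  by have := H i ((sigma i)^-1%g k); rewrite blkE permKV.
Qed.

End Covariance.

(** * Elements of W_lambda as tensor products with 1_r *)

Section Weyl.
Context {R : realType} {r s : nat} {p nu : 'I_s -> nat}.
Local Notation C := R[i].
Local Notation n := (size_lambda p nu).

(** The entries of g' are read off at a diagonal entry of 1_r, which exists as r > 0; so the choice
    in [rho] has a single candidate. *)
Lemma rho_tens1 (g : 'M[C]_n) : (0 < r)%N -> rho (g *t 1%:M : 'M[C]_(n * r)) = g.
Proof.
move=> r0; apply: xget_unique => // g' /matrixP gg'.
apply/matrixP => a b; pose y := Ordinal r0.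
have := gg' (mxtens_index (a, y)) (mxtens_index (b, y)).
by rewrite !tensmxE mxE eqxx !mulr1.
Qed.

Lemma Wset_tens1 (g : 'M[C]_(n * r)) : (forall i, (0 < nu i)%N) -> Wset g ->
  exists2 g' : 'M[C]_n, g = g' *t 1%:M & chi_covariant (r := r) g'.
Proof.
move=> nu0 [_ [sigma [[c _ <-] ->]]]; exists (U_mx c *m P_mx sigma).
  by rewrite tensmx_mul mul1mx.
by apply: chi_covariantM; [exact: chi_covariant_U | exact: chi_covariant_P].
Qed.

End Weyl.

(** * Transport of cycles and integrals *)

Section Transformation.
Context {R : realType} {r s m : nat} {p nu : 'I_s -> nat}.
Local Notation C := R[i].
Local Notation n := (size_lambda p nu).
Variables (z : 'M[C]_(m, n * r)) (al : 'rV[C]_n) (g : 'M[C]_n).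
Hypothesis cov : chi_covariant (r := r) g.
Local Notation zg := (z *m (g *t 1%:M)).
Local Notation alg := (al *m g^T).

Lemma chi_values_tens1 (t : 'M[C]_(r, m)) :
  chi_values al (t *m zg) = chi_values alg (t *m z).
Proof. by rewrite mulmxA; case: (cov al (t *m z)). Qed.

Lemma mulmx_blk (z' : 'M[C]_(m, n * r)) (t : 'M[C]_(r, m)) i (k : 'I_(p i)) a :
  t *m blk z' k a = blk (t *m z') k a.
Proof.
rewrite /blk; case: insub => [b|] /=; last by rewrite mulmx0.
by apply/matrixP => x y; rewrite !mxE; apply: eq_bigr => l _; rewrite mxE.
Qed.

Lemma Xset_tens1 : Xset zg = Xset z.
Proof.
apply/seteqP; split=> x /= Xx.
all: have [_ _ XE] := cov al (frame_mx (generic_quotient.repr x) *m z).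
- move=> i k; rewrite mulmx_blk; apply: XE.1 => {}i {}k.
  by rewrite -mulmxA -mulmx_blk; apply: Xx.
- move=> i k; rewrite mulmx_blk mulmxA; apply: XE.2 => {}i {}k.
  by rewrite -mulmx_blk; apply: Xx.
Qed.

Lemma Phi_tens1 : Phi zg al = Phi z alg.
Proof.
have gE (a : R) : [set x : Gr R r m | a <= complex.Re
      (gexp al (frame_mx (generic_quotient.repr x) *m zg))] =
    [set x | a <= complex.Re
      (gexp alg (frame_mx (generic_quotient.repr x) *m z))].
  apply: eq_set => x.
  have [_ E _] := cov al (frame_mx (generic_quotient.repr x) *m z).
  by rewrite mulmxA E.
rewrite /Phi Xset_tens1; apply/funext => A; apply: (congr1 (and _)).
by apply: eq_forall => a; apply: (congr1 (fun B => compact (A `&` B)) (gE a)).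
Qed.

(** The branch is chosen from a set that is the same on both sides, so the very same function is
    selected. *)
Lemma chi_branch_tens1 d : @chi_branch R r s m p nu d zg al = chi_branch z alg.
Proof.
apply/funext => sg; apply/funext => u; rewrite /chi_branch.
apply: (congr1 (xget _)); apply: eq_set => f.
apply: (congr1 (and4 _ _ _)); apply: eq_forall => x.
by rewrite chi_values_tens1.
Qed.

Lemma radon_chain_tens1 d (c : twisted_chain R r m d) :
  radon_chain zg al c = radon_chain z alg c.
Proof.
rewrite /radon_chain Xset_tens1; apply: (congr1 (and^~ _)).
apply: eq_forall => j; by rewrite chi_values_tens1.
Qed.

(** In [boundary_coef] only the branches involve z and alpha; the faces and the factors det(A)^-m
    come from the simplices alone. *)
Lemma radon_cycle_tens1 d (c : twisted_chain R r m d) :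
  radon_cycle zg al c = radon_cycle z alg c.
Proof.
by rewrite /radon_cycle /boundary_coef chi_branch_tens1 Phi_tens1 radon_chain_tens1.
Qed.

(** [tau_pullback] depends on the simplices alone, so equal branches give the same series. *)
Lemma radon_F_tens1 (hrm : (r < m)%N) c :
  radon_F hrm zg al c = radon_F hrm z alg c.
Proof. by rewrite /radon_F /radon_term chi_branch_tens1. Qed.

End Transformation.

Theorem theorem4p5 (R : realType) (r m s : nat) (p nu : 'I_s -> nat)
  (hr : (0 < r)%N)
  (hp : forall i, (0 < p i)%N)
  (hnu : forall i, (0 < nu i)%N)
  (hdec : forall i j : 'I_s, (i < j)%N -> (nu j < nu i)%N)
  (hrm : (r < m)%N)
  (hmN : (m < size_lambda p nu * r)%N)
  (alpha : 'rV[R[i]]_(size_lambda p nu))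
  (halpha0 : forall (i : 'I_s) (k : 'I_(p i)) (l : int),
     acoef alpha k 0 <> l%:~R)
  (halpha_last : forall (i : 'I_s) (k : 'I_(p i)), (2 <= nu i)%N ->
     acoef alpha k (nu i).-1 <> 0)
  (halpha_sum : \sum_(i < s) \sum_(k < p i) acoef alpha k 0 = - m%:R)
  (z : 'M[R[i]]_(m, size_lambda p nu * r))
  (hz : Zset z) :
  (forall g : 'M[R[i]]_(size_lambda p nu * r), Wset g ->
     forall C : twisted_chain R r m (r * (m - r)),
       (radon_cycle (z *m g) alpha C <-> radon_cycle z (alpha *m (rho g)^T) C) /\
       (radon_cycle z (alpha *m (rho g)^T) C ->
        radon_F hrm (z *m g) alpha C = radon_F hrm z (alpha *m (rho g)^T) C)) /\
  (forall sigma : (forall i : 'I_s, 'S_(p i)),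
     forall C : twisted_chain R r m (r * (m - r)),
       (radon_cycle (z *m Pmx R r nu sigma) (alpha *m rho (Pmx R r nu sigma)) C
          <-> radon_cycle z alpha C) /\
       (radon_cycle z alpha C ->
        radon_F hrm (z *m Pmx R r nu sigma)
            (alpha *m rho (Pmx R r nu sigma)) C
          = radon_F hrm z alpha C)).
Proof.
split=> [g /(Wset_tens1 _ hnu)[g' -> cov] C|sigma C].
  rewrite (rho_tens1 g' hr); split=> [|_].
    by rewrite (radon_cycle_tens1 z alpha g' cov _ C); apply: iff_refl.
  exact: radon_F_tens1.
have cov := chi_covariant_P (R := R) (r := r) (nu := nu) sigma.
(* With alpha P in place of alpha, the exponents on the right become alpha P P^T, which is alpha. *)
have cycE := radon_cycle_tens1 z (alpha *m P_mx sigma) _ cov _ C.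
have F_E := radon_F_tens1 z (alpha *m P_mx sigma) _ cov hrm C.
rewrite P_mxT_mul in cycE F_E.
have -> : Pmx R r nu sigma = P_mx sigma *t 1%:M by [].
rewrite (rho_tens1 _ hr); split=> [|_].
  by rewrite cycE; apply: iff_refl.
exact: F_E.
Qed.
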